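(* Let $G$ be an undirected graph (loops allowed) without isolated vertices and with $E(G)\neq\varnothing$. Then $$\mathrm{IC}(G;K_2)=\begin{cases}\infty, & \text{if } G \text{ has loops};\\ |E(G)|, & \text{if } G \text{ does not have loops}.\end{cases}$$
   Context: An undirected graph $G$ has a vertex set $V(G)$ and an edge set $E(G)$, without multiple edges; edges are two-element sets of vertices or loops $uu$. The degree of a vertex $v$ is the number of its neighbours other than $v$; $v$ is isolated if its degree is $0$. $K_2$ is the complete graph on the vertices $1,2$ (a single edge, no loops). A homomorphism $f:G\to H$ is a map $f:V(G)\to V(H)$ with $f(u)f(v)\in E(H)$ whenever $uv\in E(G)$; it is injective if it is injective on vertices and the induced map on edges is injective (the former implies the latter). A subgraph of $G$ is a graph whose vertex and edge sets are subsets of $V(G)$, $E(G)$. The union $G_1\cup\cdots\cup G_k$ has vertex set $\bigcup_i V(G_i)$ and edge set $\bigcup_i E(G_i)$. The injective hom-complexity $\mathrm{IC}(G;H)$ is the least positive integer $k$ such that there are subgraphs $G_1,\dots,G_k$ of $G$ with $G=G_1\cup\cdots\cup G_k$ and, for each $i$, an injective homomorphism $G_i\to H$; $\mathrm{IC}(G;H)=\infty$ if no such $k$ exists. If $E(G)$ is infinite, $|E(G)|$ is read as $\infty$. *)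

(* Defs.v *)
From mathcomp Require Import all_boot.
From mathcomp Require Import boolp classical_sets functions cardinality.
From mathcomp Require Import constructive_ereal.

Set Implicit Arguments.
Unset Strict Implicit.
Unset Printing Implicit Defensive.

Local Open Scope classical_set_scope.

(* Vertices are drawn from an ambient type [T], so that subgraphs and unions
   stay in [graph T].  The edge uv is the set [set u; v]; it is the loop uu,
   that is [set u], when u = v. *)
Record graph (T : Type) := Graph {
  vset : set T;
  eset : set (set T);
  edgeP : forall e, eset e ->
    exists u v, [/\ vset u, vset v & e = [set u; v]]
}.

(* The natural numbers with infinity are [\bar nat]; -oo is never a value. *)
Definition ecard (T : Type) (A : set T) : \bar nat :=
  if pselect (finite_set A) is left finA then (projT1 (cid finA))%:E else +oo%E.

Definition degree (T : Type) (G : graph T) (v : T) : \bar nat :=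
  ecard [set u | u <> v /\ eset G [set u; v]].

(* A vertex whose only neighbour is itself is isolated. *)
Definition isolated (T : Type) (G : graph T) (v : T) : Prop :=
  vset G v /\ degree G v = 0%N%:E.

Definition has_loops (T : Type) (G : graph T) : Prop :=
  exists u, eset G [set u; u].

Definition subgraph (T : Type) (G' G : graph T) : Prop :=
  vset G' `<=` vset G /\ eset G' `<=` eset G.

Lemma gunion_edgeP (T : Type) (k : nat) (Gs : 'I_k -> graph T) (e : set T) :
  (\bigcup_i eset (Gs i)) e ->
  exists u v, [/\ (\bigcup_i vset (Gs i)) u, (\bigcup_i vset (Gs i)) v &
    e = [set u; v]].
Proof.
move=> [i _ /edgeP[u [v [Gu Gv ->]]]].
by exists u, v; split => //; exists i.
Qed.

Definition gunion (T : Type) (k : nat) (Gs : 'I_k -> graph T) : graph T :=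
  Graph (@gunion_edgeP T k Gs).

Definition is_hom (T U : Type) (G : graph T) (H : graph U)
    (f : vset G -> vset H) : Prop :=
  forall u v : vset G,
    eset G [set val u; val v] -> eset H [set val (f u); val (f v)].

(* On an edge uv of G this is the edge f(u)f(v). *)
Definition edge_map (T U : Type) (G : graph T) (H : graph U)
    (f : vset G -> vset H) (e : set T) : set U :=
  [set val (f u) | u in [set u : vset G | e (val u)]].

Definition is_inj_hom (T U : Type) (G : graph T) (H : graph U)
    (f : vset G -> vset H) : Prop :=
  [/\ is_hom f, injective f & set_inj (eset G) (edge_map f)].

Definition inj_hom_cover (T U : Type) (G : graph T) (H : graph U) (k : nat)
    : Prop :=
  exists Gs : 'I_k -> graph T,
    [/\ forall i, subgraph (Gs i) G,
        G = gunion Gs &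
        forall i, exists f : vset (Gs i) -> vset H, is_inj_hom f].

Definition IC (T U : Type) (G : graph T) (H : graph U) : \bar nat :=
  if pselect (exists k, `[< (0 < k)%N /\ inj_hom_cover G H k >]) is left exk
  then (ex_minn exk)%:E else +oo%E.

Lemma K2_edgeP (e : set nat) :
  [set [set 1%N; 2%N]] e ->
  exists u v, [/\ [set 1%N; 2%N] u, [set 1%N; 2%N] v & e = [set u; v]].
Proof. by move=> ->; exists 1%N, 2%N; split => //; [left|right]. Qed.

Definition K2 : graph nat := Graph K2_edgeP.

(* Main.v *)
(* A subgraph that maps injectively into K_2 has no loop and at most one edge,
   since K_2 is loopless with a single edge.  So a cover of G by k of them
   forces G to be loopless with at most k edges.  Conversely, when no vertex is
   isolated, a loopless G is the union of its single edges. *)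
Require Import Defs.
From mathcomp Require Import all_boot.
From mathcomp Require Import boolp classical_sets functions cardinality.
From mathcomp Require Import constructive_ereal.

Set Implicit Arguments.
Unset Strict Implicit.
Unset Printing Implicit Defensive.

Local Open Scope classical_set_scope.
Local Open Scope card_scope.

Lemma graph_eq (T : Type) (G H : graph T) :
  vset G = vset H -> eset G = eset H -> G = H.
Proof.
case: G H => [V E p] [V' E' p'] /= eqV eqE; move: p p'; rewrite eqV eqE => p p'.
by congr Graph; exact: Prop_irrelevance.
Qed.

(** The number that [cid] picks is forced, since [I_m] and [I_n] are equinumerous only for
    [m = n]. *)
Lemma ecard_eq (T : Type) (A : set T) (n : nat) : A #= `I_n -> ecard A = n%:E.
Proof.
move=> An; rewrite /ecard; case: pselect => [finA|]; last by case; exists n.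
case: cid => m /= Am; congr (_%:E); apply/card_eq_II.
by rewrite -(card_eql Am).
Qed.

Lemma edge_subset (T : Type) (G : graph T) (e : set T) :
  eset G e -> e `<=` vset G.
Proof. by move=> /edgeP[u [v [Gu Gv ->]]] x [->|->]. Qed.

(** A loop at [u] would go to a loop at [a = f u], making the singleton of [a] equal to the edge {1,
    2}. *)
Lemma inj_hom_K2_loopless (T : Type) (G : graph T) (f : vset G -> vset K2) :
  is_inj_hom f -> ~ has_loops G.
Proof.
move=> [homf _ _] [u Guu].
have Gu : vset G u by apply: edge_subset Guu _ _; left.
have := homf (SigSub (mem_set Gu)) (SigSub (mem_set Gu)) Guu.
move: (val (f _)) => a /= f12.
have : [set 1%N; 2%N] 1%N by left.
have : [set 1%N; 2%N] 2%N by right.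
by rewrite -f12 => -[<-|<-] [].
Qed.

Lemma inj_hom_K2_edge_map (T : Type) (G : graph T) (f : vset G -> vset K2) e :
  is_hom f -> eset G e -> edge_map f e = [set 1%N; 2%N].
Proof.
move=> homf Ge; have [u [v [Gu Gv eE]]] := edgeP Ge.
pose su : vset G := SigSub (mem_set Gu).
pose sv : vset G := SigSub (mem_set Gv).
rewrite eE in Ge *; have /= <- := homf su sv Ge.
apply/seteqP; split => [_ [x /= [xu|xv] <-]|_ [|] ->].
- by left; congr (val (f _)); exact: val_inj.
- by right; congr (val (f _)); exact: val_inj.
- by exists su => //; left.
- by exists sv => //; right.
Qed.

(** All edges have the same image {1, 2}, so injectivity on edges identifies them. *)
Lemma inj_hom_K2_edge_unique (T : Type) (G : graph T) (f : vset G -> vset K2) :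
  is_inj_hom f -> is_subset1 (eset G).
Proof.
move=> [homf _ injf] e e' Ge Ge'; apply: injf; rewrite ?inE //.
by rewrite !inj_hom_K2_edge_map.
Qed.

Lemma inj_hom_cover_K2_loopless (T : Type) (G : graph T) (k : nat) :
  inj_hom_cover G K2 k -> ~ has_loops G.
Proof.
move=> [Gs [_ -> homs]] [u [i _ Guu]]; have [f injf] := homs i.
by apply: (inj_hom_K2_loopless injf); exists u.
Qed.

Lemma inj_hom_cover_K2_card_le (T : Type) (G : graph T) (k : nat) :
  inj_hom_cover G K2 k -> eset G #<= `I_k.
Proof.
move=> [Gs [_ -> homs]].
(* [g j] is the only possible edge of the [j]-th subgraph. Taking [j] in [nat] makes [E(G)] part of
   the image of [I_k] under [g]; [set0] is a dummy value when [j >= k] or the subgraph has no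
   edge. *)
have /choice[g gE] (j : nat) :
    exists e, forall i : 'I_k, i = j :> nat -> eset (Gs i) `<=` [set e].
  have [jk|kj] := ltnP j k; last first.
    by exists set0 => i ij; have := ltn_ord i; rewrite ij ltnNge kj.
  have [f injf] := homs (Ordinal jk).
  have uniqE := inj_hom_K2_edge_unique injf.
  have [[e Ge]|noE] := pselect (eset (Gs (Ordinal jk)) !=set0).
    exists e => i ij e' /=; have -> : i = Ordinal jk by exact: val_inj.
    by move=> Ge'; exact: uniqE.
  exists set0 => i ij e' Ge'; case: noE; exists e'.
  by have <- : i = Ordinal jk by exact: val_inj.
apply: card_le_trans (card_image_le g `I_k); apply: subset_card_le.
by move=> e [i _ Ge]; exists (val i); rewrite /= ?ltn_ord // (gE i i erefl e Ge).
Qed.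

Lemma edge_graph_edgeP (T : Type) (u v : T) (e : set T) :
  [set [set u; v]] e ->
  exists x y, [/\ [set u; v] x, [set u; v] y & e = [set x; y]].
Proof. by move=> ->; exists u, v; split => //; [left|right]. Qed.

Definition edge_graph (T : Type) (u v : T) : graph T :=
  Graph (@edge_graph_edgeP T u v).

Lemma edge_graph_inj_hom (T : Type) (u v : T) : u <> v ->
  exists f : vset (edge_graph u v) -> vset K2, is_inj_hom f.
Proof.
move=> uv.
have K1 : vset K2 1%N by left.
have K22 : vset K2 2%N by right.
(* [u] goes to 1 and the only other vertex, [v], to 2. *)
pose f (x : vset (edge_graph u v)) : vset K2 :=
  if pselect (val x = u) then SigSub (mem_set K1) else SigSub (mem_set K22).
have memE (x : vset (edge_graph u v)) : val x = u \/ val x = v.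
  exact: (set_mem (valP x)).
exists f; split.
- move=> x y /= xyE; rewrite /f.
  (* Both [u] and [v] occur among the ends [x], [y] of the edge, so the ends cannot both be [u] nor
     both differ from [u]. *)
  have xyu : [set val x; val y] u by rewrite xyE; left.
  have xyv : [set val x; val y] v by rewrite xyE; right.
  case: pselect => [xu|xu]; case: pselect => [yu|yu] //=.
  + by case: xyv => /esym; rewrite ?xu ?yu => /uv.
  + by rewrite setUC.
  + by case: xyu => /esym.
- move=> x y; rewrite /f.
  case: pselect => [xu|xu]; case: pselect => [yu|yu] //= _; apply: val_inj.
    by rewrite xu.
  by case: (memE x) => // ->; case: (memE y).
- by move=> e e' /set_mem -> /set_mem ->.
Qed.

Lemma non_isolated_edge (T : Type) (G : graph T) (v : T) :
  vset G v -> ~ isolated G v -> exists2 u, u <> v & eset G [set u; v].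
Proof.
move=> Gv niso; apply: contrapT => noE; apply: niso; split=> //.
apply: ecard_eq; rewrite II0 card_eq0; apply/eqP/seteqP.
split=> // u [uv Guv].
by apply: noE; exists u.
Qed.

Lemma inj_hom_cover_K2 (T : Type) (G : graph T) (n : nat) :
  (forall v, ~ isolated G v) -> ~ has_loops G -> eset G #= `I_n ->
  inj_hom_cover G K2 n.
Proof.
move=> niso noloop; rewrite card_eq_sym => /card_set_bijP[g [gE _ gsurj]].
(* [g] enumerates the edges; [h i] chooses an ordered pair of ends of the [i]-th one, distinct
   because that edge is not a loop. *)
have /choice[h hP] (i : 'I_n) : exists p : T * T,
    [/\ p.1 <> p.2, g i = [set p.1; p.2] & eset G (g i)].
  have Gg : eset G (g i) by apply: gE => /=.
  have [u [v [_ _ giE]]] := edgeP Gg; exists (u, v); split=> // uv.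
  by apply: noloop; exists u; rewrite {2}[u]uv -giE.
exists (fun i => edge_graph (h i).1 (h i).2); split.
- move=> i; have [_ giE Gg] := hP i; split=> [|e /= ->]; last by rewrite -giE.
  by rewrite /= -giE; exact: edge_subset.
- have eE : eset G = \bigcup_i eset (edge_graph (h i).1 (h i).2).
    apply/seteqP; split=> [e /gsurj[i /= ltin <-]|e [i _ /= ->]].
      by exists (Ordinal ltin) => //=; have [_ <-] := hP (Ordinal ltin).
    by have [_ <-] := hP i.
  (* The single edges also cover the vertices: a non-isolated [v] is an end of some edge. *)
  apply: graph_eq => //=; apply/seteqP; split=> [v Gv|v [i _]].
    have [u _] := non_isolated_edge Gv (niso v).
    rewrite eE => -[i _ /= uvE]; exists i => //.
    have uv_v : [set u; v] v by right.
    by rewrite uvE in uv_v.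
  by have [_ <- Gg] := hP i; exact: edge_subset.
- by move=> i; have [neq _ _] := hP i; exact: edge_graph_inj_hom.
Qed.

Theorem theorem3p14 (T : Type) (G : graph T)
    (no_isolated : forall v, ~ isolated G v)
    (E_neq0 : eset G !=set0) :
  IC G K2 = if `[< has_loops G >] then +oo%E else ecard (eset G).
Proof.
rewrite /IC; case: asboolP => [loop|noloop].
  case: pselect => // exk; have [k /asboolP[_ cover]] := exk.
  by have := inj_hom_cover_K2_loopless cover.
have [[n En]|infE] := pselect (finite_set (eset G)); last first.
  (* For infinite [E(G)] both sides are [+oo]: a cover by [k] subgraphs would bound the number of
     edges by [k]. *)
  rewrite /ecard; case: (pselect (finite_set _)) => // _.
  case: pselect => // exk; have [k /asboolP[_ cover]] := exk; case: infE.
  exact: card_le_finite (inj_hom_cover_K2_card_le cover) (finite_II k).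
(* [IC] ranges over positive [k] only, so [n] qualifies because [G] has an edge. *)
have n_gt0 : (0 < n)%N.
  rewrite lt0n; apply/eqP => n0; move: En; rewrite n0 II0 card_eq0 => /eqP E0.
  by case: E_neq0 => e; rewrite E0.
have cover := inj_hom_cover_K2 no_isolated noloop En.
rewrite (ecard_eq En); case: pselect => [exk|]; last first.
  by case; exists n; exact/asboolP.
case: ex_minnP => m /asboolP[_ coverm] min_m; congr (_%:E); apply/eqP.
(* Minimality of [m] gives [m <= n] by the cover with single edges; the edge bound for the cover of
   size [m] gives [n <= m]. *)
rewrite eqn_leq min_m /=; last exact/asboolP.
by rewrite -card_le_II -(card_le_eql En); exact: inj_hom_cover_K2_card_le.
Qed.
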